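(* Let $(Q,P):\mathbb{R}\to SE(3)\times\mathbb{R}^6$ with input $F:\mathbb{R}\to\mathbb{R}^6$, and $(Q_d,P_d):\mathbb{R}\to SE(3)\times\mathbb{R}^6$ with input $F_d:\mathbb{R}\to\mathbb{R}^6$, both satisfy the submersible dynamics $$\dot Q = Q\,U^\wedge,\quad \dot P = \mathrm{ad}^{*\vee}_{U}P+F,\quad U=\mathbb{I}^{-1}P;\qquad \dot Q_d = Q_d\,U_d^\wedge,\quad \dot P_d=\mathrm{ad}^{*\vee}_{U_d}P_d+F_d,\quad U_d=\mathbb{I}^{-1}P_d .$$ Define the right-invariant error $$(Q_E,P_E) = (Q,P)(Q_d,P_d)^{-1} = \left(QQ_d^{-1},\ \mathrm{Ad}^{*\vee}_{Q_d^{-1}}(P-P_d)\right)$$ with respect to the semi-direct product group structure on $SE(3)\times\mathbb{R}^6$ with multiplication $(Q_1,P_1)(Q_2,P_2)=(Q_1Q_2,\ \mathrm{Ad}^{*\vee}_{Q_2}P_1+P_2)$, and define $$U_E=\mathrm{Ad}^\vee_{Q_d}(U-U_d),\quad \bar{\mathbb{I}}_t=\mathrm{Ad}^{*\vee}_{Q_d^{-1}}\,\mathbb{I}\,\mathrm{Ad}^{\vee}_{Q_d^{-1}},\quad H_E=\tfrac12P_E^\top\bar{\mathbb{I}}_t^{-1}P_E,\quad F_E=\mathrm{ad}^{*\vee}_{U_E}\mathrm{Ad}^{*\vee}_{Q_d^{-1}}P_d+\mathrm{Ad}^{*\vee}_{Q_d^{-1}}(F-F_d).$$ Then the error dynamics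 are those of a (time-varying) Lie-Poisson Hamiltonian system on $SE(3)\times\mathbb{R}^6$ with Hamiltonian $H_E$ and input $F_E$, namely $$\dot Q_E=Q_E\,U_E^\wedge,\qquad \dot P_E=\mathrm{ad}^{*\vee}_{U_E}P_E+F_E,\qquad U_E=\frac{\partial H_E}{\partial P_E}=\bar{\mathbb{I}}_t^{-1}P_E .$$
   Context: $SE(3)$ is the group of rigid motions, with elements written $(R,x)$, $R\in SO(3)$, $x\in\mathbb{R}^3$, identified with the matrix $\begin{pmatrix} R & x \\ 0 & 1 \end{pmatrix}$. For $\omega\in\mathbb{R}^3$, $\omega^\times$ is the skew-symmetric $3\times3$ matrix with $\omega^\times u=\omega\times u$. For $U=(\omega,v)\in\mathbb{R}^6$, $U^\wedge=\begin{pmatrix} \omega^\times & v \\ 0 & 0 \end{pmatrix}\in\mathfrak{se}(3)$. The dual $\mathfrak{se}(3)^*$ is identified with $\mathbb{R}^6$ by the standard inner product. The adjoint operators are the $6\times6$ matrices $$\mathrm{Ad}^\vee_{(R,x)}=\begin{pmatrix} R & 0 \\ {x}^\times R & R \end{pmatrix},\quad \mathrm{Ad}^{*\vee}_{(R,x)}=\begin{pmatrix} R^\top & -R^\top x^\times \\ 0 & R^\top \end{pmatrix},\quad \mathrm{ad}^\vee_{(\omega,v)}=\begin{pmatrix} \omega^\times & 0 \\ {v}^\times & \omega^\times \end{pmatrix},\quad \mathrm{ad}^{*\vee}_{(\omega,v)}=\begin{pmatrix} -\omega^\times & -v^\times \\ 0 & -\omega^\times \end{pmatrix}.$$ $\mathbb{I}\in\mathbb{R}^{6\times6}$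 is a constant symmetric positive-definite (coupled rotational-translational, including added mass) inertia matrix; $U=(\omega,v)$ are body-frame angular and linear velocities, $P=\mathbb{I}U=(\pi,p)$ the momentum, and $F=(\tau,f)$ the control torque and force. *)

(* Defs.v *)
From HB Require Import structures.
From mathcomp Require Import all_boot all_order all_algebra.
From mathcomp Require Import ring.
From mathcomp Require Import all_classical all_reals all_analysis.

Set Implicit Arguments.
Unset Strict Implicit.
Unset Printing Implicit Defensive.

Import Order.TTheory GRing.Theory Num.Theory.
Import numFieldNormedType.Exports.

Local Open Scope ring_scope.

Section RigidMotions.
Variable R : realType.

Definition cross (u v : 'cV[R]_3) : 'cV[R]_3 :=
  \col_(i < 3) [:: u 1 0 * v 2 0 - u 2 0 * v 1 0;
                   u 2 0 * v 0 0 - u 0 0 * v 2 0;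
                   u 0 0 * v 1 0 - u 1 0 * v 0 0]`_i.

Definition skew (w : 'cV[R]_3) : 'M[R]_3 :=
  \matrix_(i < 3, j < 3)
    (nth [::] [:: [::       0; - w 2 0;   w 1 0];
                  [::   w 2 0;       0; - w 0 0];
                  [:: - w 1 0;   w 0 0;       0]] i)`_j.

Lemma skewE (w u : 'cV[R]_3) : skew w *m u = cross w u.
Proof.
have e1 : lift ord0 ord0 = 1 :> 'I_3 by apply/val_inj.
have e2 : lift ord0 (lift ord0 ord0) = 2 :> 'I_3 by apply/val_inj.
apply/matrixP => i j; rewrite ord1 !mxE !big_ord_recl big_ord0 !mxE /= e1 e2.
by case: i => [] [|[|[|//]]] ? /=; ring.
Qed.

Definition SO3 : {pred 'M[R]_3} := [pred A | (A^T *m A == 1%:M) && (\det A == 1)].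

Record SE3 := MkSE3 {
  se3_val : 'M[R]_3 * 'cV[R]_3;
  se3_valP : se3_val.1 \in SO3 }.
HB.instance Definition _ := [isSub for se3_val].
HB.instance Definition _ := [Choice of SE3 by <:].

Definition rot (g : SE3) : 'M[R]_3 := (se3_val g).1.
Definition trans (g : SE3) : 'cV[R]_3 := (se3_val g).2.

Definition se3_mx (g : SE3) : 'M[R]_4 :=
  block_mx (rot g) (trans g) 0 (1%:M : 'M[R]_1).

Lemma rotP (g : SE3) : rot g \in SO3. Proof. exact: se3_valP. Qed.

Lemma SO3_trl A : A \in SO3 -> A^T *m A = 1%:M.
Proof. by case/andP => /eqP. Qed.

Lemma SO3_trr A : A \in SO3 -> A *m A^T = 1%:M.
Proof. by move=> /SO3_trl/mulmx1C. Qed.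

Lemma SO3_1 : 1%:M \in SO3.
Proof. by rewrite inE trmx1 mulmx1 det1 !eqxx. Qed.

Lemma SO3_M A B : A \in SO3 -> B \in SO3 -> A *m B \in SO3.
Proof.
move=> sA sB; case/andP: (sA) (sB) => _ /eqP dA /andP[_ /eqP dB].
rewrite inE det_mulmx dA dB mulr1 eqxx andbT trmx_mul mulmxA.
by rewrite -(mulmxA B^T) SO3_trl // mulmx1 SO3_trl.
Qed.

Lemma SO3_T A : A \in SO3 -> A^T \in SO3.
Proof.
move=> sA; case/andP: (sA) => _ dA.
by rewrite inE trmxK SO3_trr // eqxx det_tr.
Qed.

Definition se3_one : SE3 := @MkSE3 (1%:M, 0) SO3_1.
Definition se3_mul (g h : SE3) : SE3 :=
  @MkSE3 (rot g *m rot h, rot g *m trans h + trans g) (SO3_M (rotP g) (rotP h)).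
Definition se3_inv (g : SE3) : SE3 :=
  @MkSE3 ((rot g)^T, - ((rot g)^T *m trans g)) (SO3_T (rotP g)).

Lemma SE3_eq (g h : SE3) : rot g = rot h -> trans g = trans h -> g = h.
Proof.
case: g h => [[A x] gP] [[B y] hP] /= eAB exy; apply/val_inj => /=.
by congr pair.
Qed.

Lemma se3_mulA : associative se3_mul.
Proof.
move=> g h k; apply: SE3_eq; rewrite /rot /trans /=; first exact: mulmxA.
by rewrite mulmxDr mulmxA addrA.
Qed.

Lemma se3_mul1 : left_id se3_one se3_mul.
Proof. by move=> g; apply: SE3_eq; rewrite /rot /trans /= !mul1mx ?addr0. Qed.

Lemma se3_mulr1 : right_id se3_one se3_mul.
Proof.
by move=> g; apply: SE3_eq; rewrite /rot /trans /= ?mulmx1 ?mulmx0 ?add0r.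
Qed.

Lemma se3_mulV : left_inverse se3_one se3_inv se3_mul.
Proof.
move=> g; apply: SE3_eq; first exact: SO3_trl (rotP g).
by rewrite /trans /= /rot /= subrr.
Qed.

Lemma se3_mulrV : right_inverse se3_one se3_inv se3_mul.
Proof.
move=> g; apply: SE3_eq; first exact: SO3_trr (rotP g).
by rewrite /trans /= mulmxN mulmxA SO3_trr ?rotP // mul1mx addNr.
Qed.

HB.instance Definition _ :=
  isGroup.Build SE3 se3_mulA se3_mul1 se3_mulr1 se3_mulV se3_mulrV.

(* the group law of SE3 is matrix multiplication *)
Lemma se3_mx1 : se3_mx 1%g = 1%:M.
Proof. by rewrite /se3_mx /rot /trans /= -scalar_mx_block. Qed.

Lemma se3_mxM (g h : SE3) : se3_mx (g * h)%g = se3_mx g *m se3_mx h.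
Proof.
rewrite /se3_mx [RHS](@mulmx_block R 3 1 3 1 3 1).
by rewrite !mulmx0 !mul0mx mulmx1 addr0 !add0r mulmx1.
Qed.

Definition ang (U : 'cV[R]_6) : 'cV[R]_3 := usubmx (U : 'cV[R]_(3 + 3)).
Definition lin (U : 'cV[R]_6) : 'cV[R]_3 := dsubmx (U : 'cV[R]_(3 + 3)).

Definition wedge (U : 'cV[R]_6) : 'M[R]_4 :=
  block_mx (skew (ang U)) (lin U) 0 (0 : 'M[R]_1).

Definition Ad (g : SE3) : 'M[R]_6 :=
  block_mx (rot g) 0 (skew (trans g) *m rot g) (rot g).

Definition Adstar (g : SE3) : 'M[R]_6 :=
  block_mx (rot g)^T (- ((rot g)^T *m skew (trans g))) 0 (rot g)^T.

Definition ad (U : 'cV[R]_6) : 'M[R]_6 :=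
  block_mx (skew (ang U)) 0 (skew (lin U)) (skew (ang U)).

Definition adstar (U : 'cV[R]_6) : 'M[R]_6 :=
  block_mx (- skew (ang U)) (- skew (lin U)) 0 (- skew (ang U)).

Lemma skew_tr (w : 'cV[R]_3) : (skew w)^T = - skew w.
Proof.
apply/matrixP => i j; rewrite !mxE.
by case: i j => [] [|[|[|//]]] ? [] [|[|[|//]]] ? /=; rewrite ?oppr0 ?opprK.
Qed.

Lemma skewD (u v : 'cV[R]_3) : skew (u + v) = skew u + skew v.
Proof.
apply/matrixP => i j; rewrite !mxE.
by case: i j => [] [|[|[|//]]] ? [] [|[|[|//]]] ? /=; ring.
Qed.

Lemma Adstar_tr (g : SE3) : Adstar g = (Ad g)^T.
Proof.
rewrite /Adstar /Ad (@tr_block_mx _ 3 3 3 3) trmx0.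
by rewrite trmx_mul skew_tr mulmxN.
Qed.

Lemma skew_congr (A : 'M[R]_3) (x : 'cV[R]_3) :
  A^T *m skew (A *m x) *m A = \det A *: skew x.
Proof.
pose a m n := A (inord m) (inord n); pose y m := x (inord m) 0.
have aE i j : A i j = a i j by rewrite /a !inord_val.
have yE i : x i 0 = y i by rewrite /y inord_val.
rewrite (expand_det_row _ 0) !big_ord_recl big_ord0 /cofactor.
rewrite !(expand_det_row _ 0) !big_ord_recl !big_ord0 /cofactor !det_mx11.
apply/matrixP => i j.
rewrite !mxE !big_ord_recl !big_ord0 !mxE !big_ord_recl !big_ord0 !mxE /=.
rewrite !aE !yE /=.
case: i j => [] [|[|[|//]]] ? [] [|[|[|//]]] ? /=;
  rewrite ?(big_ord_recl, big_ord0) ?aE ?yE /= /bump /= ?(add0n, add1n, addn0); ring.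
Qed.

Lemma skewM (A : 'M[R]_3) (x : 'cV[R]_3) :
  A \in SO3 -> skew (A *m x) *m A = A *m skew x.
Proof.
move=> sA; have := skew_congr A x; case/andP: (sA) => _ /eqP ->.
by rewrite scale1r => <-; rewrite !mulmxA SO3_trr // mul1mx.
Qed.

Lemma Ad1 : Ad 1%g = 1%:M.
Proof.
have skew0 : skew 0 = 0.
  apply/matrixP => i j; rewrite !mxE.
  by case: i j => [] [|[|[|//]]] ? [] [|[|[|//]]] ? /=; rewrite ?oppr0.
by rewrite /Ad /rot /trans /= skew0 mul0mx -scalar_mx_block.
Qed.

Lemma AdM (g h : SE3) : Ad (g * h)%g = Ad g *m Ad h.
Proof.
rewrite /Ad [RHS](@mulmx_block R 3 3 3 3 3 3).
rewrite !mulmx0 !mul0mx !addr0 !add0r.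
congr (@block_mx R 3 3 3 3 _ _ _ _).
rewrite [rot _]/= [trans _]/= skewD mulmxDl addrC.
by rewrite !mulmxA skewM ?rotP.
Qed.

Lemma Adstar1 : Adstar 1%g = 1%:M.
Proof. by rewrite Adstar_tr Ad1 trmx1. Qed.

Lemma AdstarM (g h : SE3) : Adstar (g * h)%g = Adstar h *m Adstar g.
Proof. by rewrite !Adstar_tr AdM trmx_mul. Qed.

(* The semi-direct product SE(3) x R^6; a record, so that the componentwise
   group structure on pairs is not picked up. *)
Record SE3P := MkSE3P { config : SE3; momentum : 'cV[R]_6 }.

Definition SE3P_pair (X : SE3P) := (config X, momentum X).
Definition pair_SE3P (X : SE3 * 'cV[R]_6) := MkSE3P X.1 X.2.
Lemma SE3P_pairK : cancel SE3P_pair pair_SE3P. Proof. by case. Qed.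
HB.instance Definition _ := Choice.copy SE3P (can_type SE3P_pairK).

Definition sd_one : SE3P := MkSE3P 1%g 0.
Definition sd_mul (X Y : SE3P) : SE3P :=
  MkSE3P (config X * config Y)%g
         (Adstar (config Y) *m momentum X + momentum Y).
Definition sd_inv (X : SE3P) : SE3P :=
  MkSE3P (config X)^-1%g (- (Adstar (config X)^-1%g *m momentum X)).

Lemma sd_mulA : associative sd_mul.
Proof.
case=> g p [h q] [k r]; rewrite /sd_mul /= mulgA AdstarM.
by rewrite mulmxDr !mulmxA addrA.
Qed.

Lemma sd_mul1 : left_id sd_one sd_mul.
Proof. by case=> g p; rewrite /sd_mul /= mul1g mulmx0 add0r. Qed.

Lemma sd_mulr1 : right_id sd_one sd_mul.
Proof. by case=> g p; rewrite /sd_mul /= mulg1 Adstar1 mul1mx addr0. Qed.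

Lemma sd_mulV : left_inverse sd_one sd_inv sd_mul.
Proof.
case=> g p; rewrite /sd_mul /= mulVg mulmxN mulmxA -AdstarM mulVg Adstar1.
by rewrite mul1mx addNr.
Qed.

Lemma sd_mulrV : right_inverse sd_one sd_inv sd_mul.
Proof. by case=> g p; rewrite /sd_mul /= mulgV subrr. Qed.

HB.instance Definition _ :=
  isGroup.Build SE3P sd_mulA sd_mul1 sd_mulr1 sd_mulV sd_mulrV.

Definition sym_posdef n (M : 'M[R]_n) : Prop :=
  M^T = M /\ forall u : 'cV[R]_n, u != 0 -> 0 < (u^T *m M *m u) 0 0.

(* The gradient represents the (Frechet) differential through the standard
   inner product, which identifies R^6 with its dual. *)
Definition is_gradient n (f : 'cV[R]_n.+1 -> R) (p g : 'cV[R]_n.+1) : Prop :=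
  is_diff p f (fun h => (g^T *m h) 0 0).

(* Curves in SE(3) are differentiated as curves of 4 x 4 matrices. *)
Definition controlled_motion (Q : R -> SE3) (P U F : R -> 'cV[R]_6) : Prop :=
  forall t : R,
    is_derive t (1 : R) (fun s => se3_mx (Q s)) (se3_mx (Q t) *m wedge (U t)) /\
    is_derive t (1 : R) P (adstar (U t) *m P t + F t).

End RigidMotions.

(* Main.v *)
(** Writing [W := U - Ud], the product rule and [d(Qd^-1) = - Ud^ Qd^-1] give
    [d(Q Qd^-1) = Q W^ Qd^-1], and conjugating [W^] past [Qd] turns it into
    [(Ad Qd W)^].  Dually [d(Adstar Qd^-1) = - Adstar Qd^-1 adstar Ud], so the
    two [adstar Ud] contributions to the derivative of the momentum error
    combine to [Adstar Qd^-1 adstar W P]; the intertwining relation between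
    [adstar] and [Adstar] moves [Adstar Qd^-1] to the right, and splitting
    [P = (P - Pd) + Pd] produces the drift term of the error input. *)
Require Import Defs.
From mathcomp Require Import all_boot all_order all_algebra.
From mathcomp Require Import ring.
From mathcomp Require Import all_classical all_reals all_analysis.
Import Order.TTheory GRing.Theory Num.Theory.
Import numFieldNormedType.Exports.
Import Defs.
Local Open Scope ring_scope.

(** * Calculus of matrix-valued curves and quadratic forms *)

Section MatrixCalculus.
Context {R : realType}.
Implicit Types t : R.

(** Reduces matrix calculus to scalar calculus: the product, transpose, block and [skew] rules below
    all follow by working entry by entry. *)
Lemma is_derive_mxP {m n} (M : R -> 'M[R]_(m, n)) dM t :
  is_derive t (1 : R) M dM <->
  forall i j, is_derive t (1 : R) (fun s => M s i j) (dM i j).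
Proof.
split=> [[dM1 <-] i j|dM1].
  rewrite derive_mx // mxE; apply: derivableP.
  by apply: (derivable_mxP M t 1).1.
have Mt : derivable M t 1.
  by apply/derivable_mxP => i j; apply: (@ex_derive _ _ _ _ _ _ _ (dM1 i j)).
split=> //; rewrite derive_mx //; apply/matrixP => i j; rewrite mxE.
exact: (@derive_val _ _ _ _ _ _ _ (dM1 i j)).
Qed.

Lemma is_derive_mulmx {m n p} (A : R -> 'M[R]_(m, n)) (B : R -> 'M[R]_(n, p))
    dA dB t :
  is_derive t (1 : R) A dA -> is_derive t (1 : R) B dB ->
  is_derive t (1 : R) (fun s => A s *m B s) (dA *m B t + A t *m dB).
Proof.
move=> /is_derive_mxP hA /is_derive_mxP hB; apply/is_derive_mxP => i j.
have -> : (fun s => (A s *m B s) i j) =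
    \sum_k ((fun s => A s i k) * (fun s => B s k j)).
  by apply/funext => s; rewrite mxE fct_sumE.
have /is_derive_eq := is_derive_sum (fun k => is_deriveM (hA i k) (hB k j)).
apply.
rewrite !mxE -big_split /=; apply: eq_bigr => k _.
by rewrite /GRing.scale /= addrC [B t k j * _]mulrC.
Qed.

Lemma is_derive_trmx {m n} (A : R -> 'M[R]_(m, n)) dA t :
  is_derive t (1 : R) A dA -> is_derive t (1 : R) (fun s => (A s)^T) dA^T.
Proof.
move=> /is_derive_mxP hA; apply/is_derive_mxP => i j; rewrite mxE.
by under eq_fun do rewrite mxE; apply: hA.
Qed.

(** Left to right, this extracts the motion of [rot] and [trans] from that of [se3_mx]; right to
    left, it assembles the derivatives of inverses and of [Adstar]. *)
Lemma is_derive_block_mx {m1 m2 n1 n2}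
    (A : R -> 'M[R]_(m1, n1)) (B : R -> 'M[R]_(m1, n2))
    (C : R -> 'M[R]_(m2, n1)) (D : R -> 'M[R]_(m2, n2)) dA dB dC dD t :
  is_derive t (1 : R) (fun s => block_mx (A s) (B s) (C s) (D s))
    (block_mx dA dB dC dD) <->
  [/\ is_derive t (1 : R) A dA, is_derive t (1 : R) B dB,
      is_derive t (1 : R) C dC & is_derive t (1 : R) D dD].
Proof.
split=> [/is_derive_mxP h|[/is_derive_mxP hA /is_derive_mxP hB
                           /is_derive_mxP hC /is_derive_mxP hD]].
  split; apply/is_derive_mxP => i j.
  - have := h (lshift m2 i) (lshift n2 j).
    by rewrite block_mxEul; under eq_fun do rewrite block_mxEul.
  - have := h (lshift m2 i) (rshift n1 j).
    by rewrite block_mxEur; under eq_fun do rewrite block_mxEur.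
  - have := h (rshift m1 i) (lshift n2 j).
    by rewrite block_mxEdl; under eq_fun do rewrite block_mxEdl.
  - have := h (rshift m1 i) (rshift n1 j).
    by rewrite block_mxEdr; under eq_fun do rewrite block_mxEdr.
apply/is_derive_mxP => i j; rewrite -(splitK i) -(splitK j).
case: (fintype.split i) (fintype.split j) => k [] l /=.
- by rewrite block_mxEul; under eq_fun do rewrite block_mxEul; apply: hA.
- by rewrite block_mxEur; under eq_fun do rewrite block_mxEur; apply: hB.
- by rewrite block_mxEdl; under eq_fun do rewrite block_mxEdl; apply: hC.
- by rewrite block_mxEdr; under eq_fun do rewrite block_mxEdr; apply: hD.
Qed.

Lemma is_derive_skew (x : R -> 'cV[R]_3) dx t :
  is_derive t (1 : R) x dx ->
  is_derive t (1 : R) (fun s => skew (x s)) (skew dx).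
Proof.
move=> /is_derive_mxP hx; apply/is_derive_mxP => i j.
have hN k : is_derive t (1 : R) (fun s => - x s k 0) (- dx k 0).
  exact: is_deriveN (hx k 0).
have -> : (fun s => skew (x s) i j) = fun s =>
    (nth [::] [:: [::       0; - x s 2 0;   x s 1 0];
                  [::   x s 2 0;       0; - x s 0 0];
                  [:: - x s 1 0;   x s 0 0;       0]] i)`_j.
  by apply/funext => s; rewrite mxE.
rewrite mxE; case: i j => [] [|[|[|//]]] ? [] [|[|[|//]]] ? /=;
  first [exact: is_derive_cst | exact: hx | exact: hN].
Qed.

Lemma is_diff_sum {V W : normedModType R} n (f df : 'I_n -> V -> W) (p : V) :
  (forall i, is_diff p (f i) (df i)) ->
  is_diff p (\sum_i f i) (\sum_i df i).
Proof.
move=> h; elim/big_ind2 : _ => // [|f1 d1 f2 d2 h1 h2].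
  exact: is_diff_cst.
exact: is_diffD.
Qed.

Lemma is_diff_mulmx_coord {m n} (A : 'M[R]_(m, n)) (p : 'cV[R]_n) i :
  is_diff p (fun q => (A *m q) i 0) (fun h => (A *m h) i 0).
Proof.
have E : (fun q : 'cV[R]_n => (A *m q) i 0) =
    \sum_k (A i k \*: (fun q : 'cV[R]_n => q k 0 : R)).
  by apply/funext => q; rewrite mxE fct_sumE.
have hc k : is_diff p (fun q : 'cV[R]_n => q k 0 : R) (fun q => q k 0).
  (* The coordinate is packaged as a linear map: being continuous, it is its own differential. *)
  have @f : {linear 'cV[R]_n -> R}.
    by exists (fun N : 'cV[R]_n => N k 0); do 2![eexists]; do ?[constructor];
      rewrite ?mxE// => ? *; rewrite ?mxE//; move=> ?; rewrite !mxE.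
  have fc : continuous f by apply: coord_continuous.
  suff : is_diff p f f by [].
  by apply: DiffDef; [apply: linear_differentiable|apply: diff_lin].
have := is_diff_sum _ _ _ _ (fun k => is_diffZ (A i k) (hc k)).
by rewrite -E.
Qed.

(** The product rule yields $p^\top M h + (Mp)^\top h$; symmetry of $M$ makes the two terms equal,
    and the factor $1/2$ absorbs the doubling. *)
Lemma is_gradient_quadratic n (M : 'M[R]_n.+1) (p : 'cV[R]_n.+1) : M^T = M ->
  is_gradient (fun q => 2^-1 * (q^T *m M *m q) 0 0) p (M *m p).
Proof.
move=> Ms; rewrite /is_gradient.
(* Writing $q$ as [1%:M *m q] lets [is_diff_mulmx_coord] treat both factors. *)
have -> : (fun q : 'cV[R]_n.+1 => 2^-1 * (q^T *m M *m q) 0 0) =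
  2^-1 \*: \sum_i ((fun q => (1%:M *m q) i 0) * (fun q => (M *m q) i 0)).
  apply/funext => q; rewrite /= fct_sumE -mulmxA mxE; congr (_ * _).
  apply: eq_bigr => i _.
  by rewrite -[RHS]/((1%:M *m q) i 0 * (M *m q) i 0) mul1mx [_^T _ _]mxE.
have /is_diff_eq := is_diffZ 2^-1 (is_diff_sum _ _ _ _ (fun i =>
  is_diffM (is_diff_mulmx_coord 1%:M p i) (is_diff_mulmx_coord M p i))).
apply; apply/funext => h; rewrite fct_sumE.
rewrite -[LHS]/(2^-1 * \sum_i ((1%:M *m p) i 0 * (M *m h) i 0 +
                               (M *m p) i 0 * (1%:M *m h) i 0)) !mul1mx.
have -> : \sum_i (p i 0 * (M *m h) i 0 + (M *m p) i 0 * h i 0) =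
    (p^T *m (M *m h)) 0 0 + ((M *m p)^T *m h) 0 0.
  rewrite [(p^T *m _) 0 0]mxE [(_^T *m h) 0 0]mxE -big_split /=.
  by apply: eq_bigr => i _; rewrite [p^T _ _]mxE [_^T 0 i]mxE.
by rewrite trmx_mul Ms mulmxA mulrDr [2^-1 * _]mulrC -splitr.
Qed.

(** A nonzero row $u$ with $uM=0$ would give $uMu^\top=0$, against positivity at $u^\top$. *)
Lemma posdef_unitmx n (M : 'M[R]_n) : sym_posdef M -> M \in unitmx.
Proof.
move=> [_ Mpos]; rewrite -row_free_unit -kermx_eq0; apply/rowV0P => u.
move/sub_kermxP => uM0; apply/eqP; apply: contraTT isT => u0.
have : u^T != 0 by rewrite -trmx0 (inj_eq (@trmx_inj _ _ _)).
by move/Mpos; rewrite trmxK uM0 mul0mx mxE ltxx.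
Qed.

End MatrixCalculus.

Section RigidMotions.
Context {R : realType}.
Implicit Types (g : SE3 R) (U V : 'cV[R]_6) (t : R).

Lemma rotV g : rot g^-1%g = (rot g)^T.
Proof. by []. Qed.

Lemma transV g : trans g^-1%g = - ((rot g)^T *m trans g).
Proof. by []. Qed.

(** * Algebra of [skew], [wedge] and the adjoint operators *)

Lemma skewN (x : 'cV[R]_3) : skew (- x) = - skew x.
Proof.
apply/matrixP => i j; rewrite !mxE.
by case: i j => [] [|[|[|//]]] ? [] [|[|[|//]]] ? /=; rewrite ?oppr0.
Qed.

Lemma skewB (x y : 'cV[R]_3) : skew (x - y) = skew x - skew y.
Proof. by rewrite skewD skewN. Qed.

Lemma skewC (x y : 'cV[R]_3) : skew x *m y = - (skew y *m x).
Proof.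
rewrite !skewE; apply/matrixP => i j; rewrite !mxE.
by case: i => [] [|[|[|//]]] ? /=; ring.
Qed.

(** The Jacobi identity for the cross product: [skew] turns it into the matrix commutator. *)
Lemma skew_cross (x y : 'cV[R]_3) :
  skew (skew x *m y) = skew x *m skew y - skew y *m skew x.
Proof.
rewrite skewE; apply/matrixP => i j.
have e1 : lift ord0 ord0 = 1 :> 'I_3 by apply/val_inj.
have e2 : lift ord0 (lift ord0 ord0) = 2 :> 'I_3 by apply/val_inj.
rewrite !mxE !big_ord_recl !big_ord0 !mxE /= ?e1 ?e2.
by case: i j => [] [|[|[|//]]] ? [] [|[|[|//]]] ? /=; ring.
Qed.

Lemma ang_adjoint g U : ang (Ad g *m U) = rot g *m ang U.
Proof.
rewrite /ang -[U in LHS](vsubmxK (U : 'cV[R]_(3 + 3))).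
by rewrite (@mul_block_col R 3 3 3 3 1) col_mxKu mul0mx addr0.
Qed.

Lemma lin_adjoint g U :
  lin (Ad g *m U) = skew (trans g) *m rot g *m ang U + rot g *m lin U.
Proof.
rewrite /lin -[U in LHS](vsubmxK (U : 'cV[R]_(3 + 3))).
by rewrite (@mul_block_col R 3 3 3 3 1) col_mxKd.
Qed.

Lemma AdK g : Ad g^-1%g *m Ad g = 1%:M.
Proof. by rewrite -AdM mulVg Ad1. Qed.

Lemma AdstarK g : Adstar g *m Adstar g^-1%g = 1%:M.
Proof. by rewrite -AdstarM mulVg Adstar1. Qed.

Lemma AdstarKV g : Adstar g^-1%g *m Adstar g = 1%:M.
Proof. by rewrite -AdstarM mulgV Adstar1. Qed.

(** Rotation equivariance of [skew] removes every transpose, leaving a form that is easy to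
    differentiate. *)
Lemma AdstarV g : Adstar g^-1%g =
  block_mx (rot g) (skew (trans g) *m rot g) 0 (rot g).
Proof.
rewrite /Adstar rotV transV trmxK skewN mulmxN opprK.
by rewrite -skewM ?rotP // mulmxA SO3_trr ?rotP // mul1mx.
Qed.

Lemma angB U V : ang (U - V) = ang U - ang V.
Proof. by apply/matrixP => i j; rewrite !mxE. Qed.

Lemma linB U V : lin (U - V) = lin U - lin V.
Proof. by apply/matrixP => i j; rewrite !mxE. Qed.

Lemma wedgeB U V : wedge (U - V) = wedge U - wedge V.
Proof.
rewrite /wedge angB linB skewB (@opp_block_mx R 3 1 3 1).
by rewrite [RHS](@add_block_mx R 3 1 3 1) !subr0.
Qed.

Lemma adstarB U V : adstar (U - V) = adstar U - adstar V.
Proof.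
rewrite /adstar angB linB !skewB (@opp_block_mx R 3 3 3 3).
by rewrite [RHS](@add_block_mx R 3 3 3 3) !opprD subr0.
Qed.

(** This is $(\mathrm{Ad}_g U)^\wedge = g\,U^\wedge g^{-1}$ without the inverse. In the translation
    block, $(R\omega)^\times x$ and $x^\times R\omega$ cancel. *)
Lemma wedge_Ad g U : wedge (Ad g *m U) *m se3_mx g = se3_mx g *m wedge U.
Proof.
rewrite /wedge /se3_mx ang_adjoint lin_adjoint.
rewrite [LHS](@mulmx_block R 3 1 3 1 3 1) [RHS](@mulmx_block R 3 1 3 1 3 1).
rewrite !mulmx0 !mul0mx !mulmx1 !addr0 skewM ?rotP //.
congr (@block_mx R 3 1 3 1 _ _ _ _).
by rewrite -mulmxA addrA [X in X + _]addrC [X in X + _ + _]skewC addNr add0r.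
Qed.

(** The transposed form of $\mathrm{ad}_{\mathrm{Ad}_g
    U}\mathrm{Ad}_g=\mathrm{Ad}_g\,\mathrm{ad}_U$, which says that $\mathrm{Ad}_g$ preserves the Lie
    bracket. *)
Lemma adstar_Ad g U :
  adstar (Ad g *m U) *m Adstar g^-1%g = Adstar g^-1%g *m adstar U.
Proof.
rewrite AdstarV /adstar ang_adjoint lin_adjoint.
rewrite [LHS](@mulmx_block R 3 3 3 3 3 3) [RHS](@mulmx_block R 3 3 3 3 3 3).
rewrite !mulmx0 !mul0mx !addr0 !add0r.
rewrite !mulNmx !mulmxN skewM ?rotP //.
congr (@block_mx R 3 3 3 3 _ _ _ _).
(* In the off-diagonal block, $(x^\times R\omega)^\times$ splits into a commutator, one half of
   which cancels $(R\omega)^\times x^\times R$. *)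
rewrite -[skew (trans g) *m rot g *m ang U]mulmxA skewD skew_cross.
rewrite mulmxDl mulmxBl skewM ?rotP // -!mulmxA skewM ?rotP //.
by rewrite !opprD opprK -!addrA addrCA addKr addrC.
Qed.

(** * Derivatives along curves in $SE(3)$ *)

Lemma is_derive_rot_trans (Q : R -> SE3 R) U t :
  is_derive t (1 : R) (fun s => se3_mx (Q s)) (se3_mx (Q t) *m wedge U) ->
  is_derive t (1 : R) (fun s => rot (Q s)) (rot (Q t) *m skew (ang U)) /\
  is_derive t (1 : R) (fun s => trans (Q s)) (rot (Q t) *m lin U).
Proof.
rewrite /wedge {2}/se3_mx (@mulmx_block R 3 1 3 1 3 1).
rewrite !mulmx0 !mul0mx !addr0.
by case/(@is_derive_block_mx R 3 1 3 1).
Qed.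

(** Rather than differentiating a matrix inverse, the proof differentiates the explicit blocks
    $R^\top$ and $-R^\top x$. *)
Lemma is_derive_se3_mxV (Q : R -> SE3 R) U t :
  is_derive t (1 : R) (fun s => se3_mx (Q s)) (se3_mx (Q t) *m wedge U) ->
  is_derive t (1 : R) (fun s => se3_mx (Q s)^-1%g)
    (- (wedge U *m se3_mx (Q t)^-1%g)).
Proof.
move=> /is_derive_rot_trans[dR dx].
rewrite /wedge {2}/se3_mx (@mulmx_block R 3 1 3 1 3 1).
rewrite !mulmx0 !mul0mx !addr0 !mulmx1 (@opp_block_mx R 3 1 3 1) !oppr0.
apply/(@is_derive_block_mx R 3 1 3 1); split; [| |exact: is_derive_cst..].
  have /is_derive_eq := is_derive_trmx _ _ _ dR; apply.
  by rewrite trmx_mul skew_tr mulNmx.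
have /is_derive_eq :=
  is_deriveN (is_derive_mulmx _ _ _ _ _ (is_derive_trmx _ _ _ dR) dx).
apply; rewrite trmx_mul skew_tr transV mulmxN mulmxA SO3_trl ?rotP //.
by rewrite mul1mx !mulNmx mulmxA opprD opprK.
Qed.

Lemma is_derive_AdstarV (Q : R -> SE3 R) U t :
  is_derive t (1 : R) (fun s => se3_mx (Q s)) (se3_mx (Q t) *m wedge U) ->
  is_derive t (1 : R) (fun s => Adstar (Q s)^-1%g)
    (- (Adstar (Q t)^-1%g *m adstar U)).
Proof.
move=> /is_derive_rot_trans[dR dx].
under eq_fun do rewrite AdstarV.
rewrite AdstarV /adstar (@mulmx_block R 3 3 3 3 3 3).
rewrite !mulmx0 !mul0mx !addr0 !add0r (@opp_block_mx R 3 3 3 3) oppr0.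
rewrite !mulmxN opprD !opprK.
apply/(@is_derive_block_mx R 3 3 3 3); split; [by []| |exact: is_derive_cst|by []].
(* The off-diagonal block $x^\times R$ has derivative $(Rv)^\times R + x^\times R\,\omega^\times$,
   and $(Rv)^\times R = R\,v^\times$. *)
have /is_derive_eq := is_derive_mulmx _ _ _ _ _ (is_derive_skew _ _ _ dx) dR.
apply.
by rewrite skewM ?rotP // mulmxA.
Qed.

End RigidMotions.


Theorem mainTheorem2 (R : realType) (I : 'M[R]_6) (hI : sym_posdef I)
    (Q Qd : R -> SE3 R) (P Pd F Fd : R -> 'cV[R]_6) :
  let U (t : R) : 'cV[R]_6 := invmx I *m P t in
  let Ud (t : R) : 'cV[R]_6 := invmx I *m Pd t in
  controlled_motion Q P U F ->
  controlled_motion Qd Pd Ud Fd ->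
  let E (t : R) : SE3P R :=
    (MkSE3P (Q t) (P t) * (MkSE3P (Qd t) (Pd t))^-1)%g in
  let QE (t : R) : SE3 R := config (E t) in
  let PE (t : R) : 'cV[R]_6 := momentum (E t) in
  let UE (t : R) : 'cV[R]_6 := Ad (Qd t) *m (U t - Ud t) in
  let Ibar (t : R) : 'M[R]_6 :=
    Adstar (Qd t)^-1%g *m I *m Ad (Qd t)^-1%g in
  let HE (t : R) (p : 'cV[R]_6) : R :=
    2^-1 * (p^T *m invmx (Ibar t) *m p) 0 0 in
  let FE (t : R) : 'cV[R]_6 :=
    adstar (UE t) *m (Adstar (Qd t)^-1%g *m Pd t)
      + Adstar (Qd t)^-1%g *m (F t - Fd t) in
  [/\ forall t : R,
        E t = MkSE3P (Q t * (Qd t)^-1)%g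
                     (Adstar (Qd t)^-1%g *m (P t - Pd t)),
      controlled_motion QE PE UE FE,
      forall t : R, is_gradient (HE t) (PE t) (UE t) &
      forall t : R, UE t = invmx (Ibar t) *m PE t].
Proof.
move=> U Ud hQ hQd E QE PE UE Ibar HE FE.
have EE t : E t = MkSE3P (Q t * (Qd t)^-1)%g
                         (Adstar (Qd t)^-1%g *m (P t - Pd t)).
  by rewrite /E mulmxBr.
have QEE t : QE t = (Q t * (Qd t)^-1)%g by [].
have PEE t : PE t = Adstar (Qd t)^-1%g *m (P t - Pd t) by rewrite /PE EE.
have Iu : I \in unitmx := posdef_unitmx _ _ hI.
have IbarV t : invmx (Ibar t) = Ad (Qd t) *m invmx I *m Adstar (Qd t).
  have IbarK : Ibar t *m (Ad (Qd t) *m invmx I *m Adstar (Qd t)) = 1%:M.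
    rewrite /Ibar -!mulmxA (mulmxA (Ad _)) AdK mul1mx (mulmxA I) mulmxV //.
    by rewrite mul1mx AdstarKV.
  have [Ibaru _] := mulmx1_unit IbarK.
  by rewrite -[RHS](mulKmx Ibaru) IbarK mulmx1.
have UEE t : UE t = invmx (Ibar t) *m PE t.
  by rewrite IbarV PEE /UE /U /Ud -mulmxBr -!mulmxA (mulmxA (Adstar _))
             AdstarK mul1mx.
split=> [//|t|t|//].
- have [dQ dP] := hQ t; have [dQd dPd] := hQd t; split.
    have -> : (fun s => se3_mx (QE s)) =
        (fun s => se3_mx (Q s) *m se3_mx (Qd s)^-1%g).
      by apply/funext => s; rewrite QEE se3_mxM.
    have /is_derive_eq :=
      is_derive_mulmx _ _ _ _ _ dQ (is_derive_se3_mxV _ _ _ dQd).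
    apply; rewrite mulmxN mulmxA -mulmxBl -mulmxBr -wedgeB QEE se3_mxM -!mulmxA.
    (* Inserting $Q_d^{-1}Q_d$ on the left lets [wedge_Ad] carry $(U-U_d)^\wedge$ past $Q_d$; then
       $Q_dQ_d^{-1}$ cancels on the right. *)
    congr (_ *m _); rewrite -[LHS]mul1mx -se3_mx1 -(mulVg (Qd t)) se3_mxM.
    rewrite -mulmxA; congr (_ *m _); rewrite /UE mulmxA -wedge_Ad -mulmxA.
    by rewrite -se3_mxM mulgV se3_mx1 mulmx1.
  rewrite (funext PEE).
  have /is_derive_eq :=
    is_derive_mulmx _ _ _ _ _ (is_derive_AdstarV _ _ _ dQd) (is_deriveB dP dPd).
  (* The drift term of [FE] merges with the [PE] term, so that [adstar (UE t)] acts on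
     $\mathrm{Ad}^{*\vee}_{Q_d^{-1}}P$. *)
  apply; rewrite /FE addrA -mulmxDr -mulmxDr subrK mulmxA adstar_Ad.
  rewrite -mulmxA mulNmx -mulmxA -mulmxN -!mulmxDr; congr (_ *m _).
  (* With the common factor $\mathrm{Ad}^{*\vee}_{Q_d^{-1}}$ removed, the two terms
     $\mathrm{ad}^{*\vee}_{U_d}P_d$ on the left have opposite signs and cancel. *)
  rewrite adstarB mulmxBl mulmxBr.
  rewrite opprB opprD [X in _ + X]addrACA [LHS]addrA; congr (_ + _).
  by rewrite [LHS]addrC subrKA.
- rewrite UEE; apply: is_gradient_quadratic.
  (* The inverse of [Ibar t] is the congruence $\mathrm{Ad}\,\mathbb{I}^{-1}\mathrm{Ad}^\top$ at
     $Q_d$, hence symmetric. *)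
  by rewrite IbarV !trmx_mul Adstar_tr trmxK trmx_inv hI.1 mulmxA.
Qed.
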